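(* Let $d\geqslant 1$ and let $A=\{v_1,\dots,v_{d+1},w,\mathbf{0}\}\subset\mathbb{Z}^d$ be a set of $d+3$ (distinct) elements, where $\mathbf{0}$ is the origin, such that $A-A$ generates $\mathbb{Z}^d$ additively and the convex hull $\Delta_A$ of $A$ is a $d$-simplex with vertices $v_1,\dots,v_{d+1}$. Let $\Lambda=\mathrm{span}_{\mathbb{Z}}(\widetilde{v}_1,\dots,\widetilde{v}_{d+1})\subset\mathbb{Z}^{d+1}$, let $N_\Lambda=|\mathbb{Z}^{d+1}/\Lambda|=\mathrm{vol}(\Delta_A)\,d!$, and let $o_w$ be the order of (the class of) $(w,1)$ in the finite group $\mathbb{Z}^{d+1}/\Lambda$. Then for every integer $h\geqslant 0$, $$|hA|\leqslant\begin{cases} \sum\limits_{m=0}^{h}\binom{m+d+1}{m}, & h\leqslant o_w-1,\\[2mm] \sum\limits_{m=0}^{o_w-1}\binom{h+d+1-m}{h-m}, & o_w\leqslant h\leqslant N_\Lambda-1,\\[2mm] \sum\limits_{m=0}^{o_w-1}\binom{h+d+1-m}{h-m}-\sum\limits_{m=0}^{h-N_\Lambda}\binom{m+d+1}{m}, & N_\Lambda\leqslant h\leqslant N_\Lambda+o_w-1,\\[2mm] \sum\limits_{m=0}^{o_w-1}\binom{h+d+1-m}{h-m}-\sum\limits_{m=0}^{o_w-1}\binom{h-N_\Lambda+d+1-m}{h-N_\Lambda-m}, & h\geqslant N_\Lambda+o_w. \end{cases}$$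
   Context: For $A\subset\mathbb{Z}^d$ and an integer $h\geqslant 1$, the $h$-fold sumset is $hA=\{a_1+\dots+a_h : a_i\in A\}$ (repetitions allowed), and $0A=\{\mathbf{0}\}$. $A-A=\{a-b : a,b\in A\}$. For $v=(v^{(1)},\dots,v^{(d)})\in\mathbb{Z}^d$, its lift is $\widetilde{v}=(v^{(1)},\dots,v^{(d)},1)\in\mathbb{Z}^{d+1}$; $(w,1)$ denotes the lift of $w$. $\mathrm{vol}$ is the $d$-dimensional Lebesgue volume. *)

(* Defs.v *)
From HB Require Import structures.
From mathcomp Require Import all_boot all_order all_algebra ring_quotient.
From mathcomp Require Import finmap.
From mathcomp Require Import boolp classical_sets cardinality reals convex.

Set Implicit Arguments.
Unset Strict Implicit.
Unset Printing Implicit Defensive.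

Import Order.TTheory GRing.Theory Num.Theory.

Local Open Scope classical_set_scope.
Local Open Scope ring_scope.

Section AdditiveGroups.
Variable V : zmodType.

Definition sumset (A : {fset V}) (h : nat) : {fset V} :=
  [fset \sum_(i < h) val (tnth a i) | a : h.-tuple A]%fset.

(* [inIntSpan], made boolean so that one can form the quotient group. *)
Definition intspan n (s : n.-tuple V) : {pred V} :=
  [pred x | `[< inIntSpan s x >]].

Fact intspan_zmod_closed n (s : n.-tuple V) : zmod_closed (intspan s).
Proof.
split=> [|x y].
  by apply/asboolP; exists 0; rewrite big1 // => i _; rewrite ffunE mulr0z.
move=> /asboolP[a ->] /asboolP[b ->]; apply/asboolP; exists (a - b).
by rewrite -sumrB; apply: eq_bigr => i _; rewrite !ffunE mulrzBr.
Qed.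

HB.instance Definition _ n (s : n.-tuple V) :=
  GRing.isZmodClosed.Build V (intspan s) (intspan_zmod_closed s).

Definition generates (A : {fset V}) : Prop :=
  forall x, x \in intspan (in_tuple A).

(* The value 0 stands for an infinite order. *)
Definition order_of (x : V) : nat :=
  if pselect (exists n, (0 < n)%N && (x *+ n == 0)) is left ex_n
  then ex_minn ex_n else 0%N.

(* The value 0 stands for an infinite group. *)
Definition group_order : nat := #|` fset_set [set: V]|%fset.

End AdditiveGroups.

Definition diffset (V : zmodType) (A : {fset V}) : {fset V} :=
  [fset a - b | a in A, b in A]%fset.

Section Lifts.
Variable d : nat.

Definition lifted (x : 'rV[int]_d) : 'rV[int]_(d + 1) := row_mx x (const_mx 1).

Definition Lambda (v : 'I_d.+1 -> 'rV[int]_d) : zmodClosed 'rV[int]_(d + 1) :=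
  intspan [tuple lifted (v i) | i < d.+1].

Definition N_Lambda (v : 'I_d.+1 -> 'rV[int]_d) : nat :=
  group_order (Quotient.quot (Lambda v)).

Definition o_ (v : 'I_d.+1 -> 'rV[int]_d) (w : 'rV[int]_d) : nat :=
  order_of (\pi_(Quotient.quot (Lambda v))%qT (lifted w)).

End Lifts.

Section Convexity.
Variables (R : realType) (d : nat).

Definition conv_hull (S : set 'rV[R]_d) : set 'rV[R]_d :=
  smallest (@convex_set R 'rV[R]_d) S.

Definition real_points (A : {fset 'rV[int]_d}) : set 'rV[R]_d :=
  [set map_mx intr x | x in [set` A]].

(* [P] is a [k]-simplex whose vertices are the [k + 1] points [v i]. *)
Definition simplex_with_vertices k (P : set 'rV[R]_d)
    (v : 'I_k.+1 -> 'rV[R]_d) : Prop :=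
  free [seq v (lift ord0 i) - v ord0 | i : 'I_k] /\ P = conv_hull (range v).

End Convexity.

Arguments real_points R {d} A.

(* Main.v *)
(* In [Z^(d+1)] modulo [Lambda], [(w, 1)] has order [o] and [(0, 1)] is killed by
   [N]. Hence [o (w, 1)] and [N (0, 1)] are integer combinations of the lifted
   vertices, with nonnegative coefficients because [w] and [0] lie in the
   simplex. Each of these two relations preserves the number of summands, so
   every element of [hA] is a sum of [h] terms in which [w] occurs fewer than [o]
   times and [0] fewer than [N] times. The bounds count these multisets. *)
Require Import Defs.
From mathcomp Require Import all_boot all_order all_algebra finmap zify.
From mathcomp Require Import ring_quotient boolp classical_sets cardinality.
From mathcomp Require Import reals convex interval_inference.

Import GRing.Theory Num.Theory.
Local Open Scope ring_scope.

Set Implicit Arguments.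
Unset Strict Implicit.
Unset Printing Implicit Defensive.

(** * Affine independence and convex combinations *)

(** The zero sum eliminates [c ord0], which leaves a linear relation among the edge vectors issuing
    from [v ord0]. *)
Lemma free_affine_independent (F : fieldType) (V : vectType F) (d : nat)
    (v : 'I_d.+1 -> V) (c : 'I_d.+1 -> F) :
  free [seq v (lift ord0 i) - v ord0 | i : 'I_d] ->
  \sum_i c i = 0 -> \sum_i c i *: v i = 0 -> forall i, c i = 0.
Proof.
have -> : [seq v (lift ord0 i) - v ord0 | i : 'I_d] =
  map_tuple (fun i => v (lift ord0 i) - v ord0) (ord_tuple d).
  by [].
move=> /freeP fv; rewrite big_ord_recl => /eqP; rewrite addr_eq0 => /eqP c0.
rewrite big_ord_recl c0 => cv.
have cl i : c (lift ord0 i) = 0.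
  apply: (fv (fun i => c (lift ord0 i))); rewrite -[RHS]cv scaleNr scaler_suml.
  rewrite addrC -sumrB; apply: eq_bigr => j _.
  by rewrite -tnth_nth tnth_map tnth_ord_tuple scalerBr.
move=> i; case: (unliftP ord0 i) => [j|] ->; first exact: cl.
by rewrite c0 big1 ?oppr0.
Qed.

(** The convex combinations of the vertices form a convex set containing each vertex, hence
    containing the smallest such set. *)
Lemma conv_hull_range (R : realType) (d n : nat) (v : 'I_n.+1 -> 'rV[R]_d)
    (x : 'rV[R]_d) :
  conv_hull (range v) x ->
  exists t : 'I_n.+1 -> R,
    [/\ forall i, 0 <= t i, \sum_i t i = 1 & x = \sum_i t i *: v i].
Proof.
pose C := [set x : 'rV[R]_d | exists t : 'I_n.+1 -> R,
  [/\ forall i, 0 <= t i, \sum_i t i = 1 & x = \sum_i t i *: v i]]%classic.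
suff : (conv_hull (range v) `<=` C)%classic by apply.
apply: smallest_sub => [y z l|_ [i _ <-]].
  rewrite !inE => -[s [s0 s1 ->]] [t [t0 t1 ->]].
  exists (fun i => l%:inum * s i + (1 - l%:inum) * t i); split=> [i||].
  - by apply: addr_ge0; apply: mulr_ge0; rewrite ?s0 ?t0.
  - by rewrite big_split/= -!mulr_sumr s1 t1 !mulr1 addrC subrK.
  - rewrite /conv/= !scaler_sumr -big_split/=; apply: eq_bigr => i _.
    by rewrite [RHS]scalerDl !scalerA.
exists (fun j => (j == i)%:R); split=> [j||].
- exact: ler0n.
- by rewrite (bigD1 i)//= eqxx big1 ?addr0// => j /negbTE ->.
- rewrite (bigD1 i)//= eqxx scale1r big1 ?addr0// => j /negbTE ->.
  by rewrite scale0r.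
Qed.

(** * Orders in finite abelian groups *)

Lemma group_order_gt0 (V : zmodType) :
  finite_set [set: V]%classic -> (0 < group_order V)%N.
Proof.
move=> fV; rewrite cardfs_gt0; apply/fset0Pn; exists 0.
by rewrite in_fset_set// inE.
Qed.

(* Translation by [x] permutes the group, so both sides of
   [\sum_y (y + x) = \sum_y y] agree. *)
Lemma mulrn_group_order (V : zmodType) (x : V) : x *+ group_order V = 0.
Proof.
rewrite /group_order; have [fV|nV] := pselect (finite_set [set: V]%classic).
  pose s := enum_fset (fset_set [set: V]%classic).
  have sE y : y \in s by rewrite in_fset_set// inE.
  have : perm_eq [seq y + x | y <- s] s.
    apply: uniq_perm => [||y]; last 1 first.
    - by rewrite sE; apply/mapP; exists (y - x); rewrite ?subrK.
    - by rewrite map_inj_uniq ?fset_uniq//; exact: addIr.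
    - exact: fset_uniq.
  move/(perm_big (op := +%R) (x := 0) _ (P := xpredT) (F := id)).
  rewrite big_map/= big_split/=.
  move/(canRL (addKr _)); rewrite addNr => <-.
  by rewrite big_const_seq count_predT iter_addr_0.
(* For an infinite group [fset_set] defaults to the empty set, so the order is 0. *)
by rewrite /fset_set; case: pselect => // ?; rewrite cardfs0 mulr0n.
Qed.

(** The witness [n] rules out the default value 0 of [order_of]. *)
Lemma mulrn_order_of (V : zmodType) (x : V) (n : nat) :
  (0 < n)%N -> x *+ n = 0 -> (0 < order_of x)%N /\ x *+ order_of x = 0.
Proof.
move=> n0 xn; rewrite /order_of; case: pselect => [ex|[]].
  by case: ex_minnP => m /andP[m0 /eqP xm] _.
by exists n; rewrite n0 xn eqxx.
Qed.

(** Reducing coordinates modulo [D] moves a vector by an element of [I], so the finite box of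
    remainders meets every class. *)
Lemma finite_quotient (n : nat) (I : zmodClosed 'rV[int]_n) (D : int) :
  D != 0 -> (forall x, D *: x \in I) ->
  finite_set [set: Quotient.quot I]%classic.
Proof.
move=> D0 DI.
pose f (u : {ffun 'I_n -> 'I_(`|D|%N.+1)}) : Quotient.quot I :=
  \pi_(Quotient.quot I)%qT (\row_j (u j : nat)%:Z).
suff -> : [set: Quotient.quot I]%classic = (f @` setT)%classic.
  exact/finite_image/finite_finset.
apply/seteqP; split=> // q _; rewrite -[q]reprK.
move: (repr q) => x; exists [ffun j => inord `|modz (x ord0 j) D|%N] => //.
apply/eqP; rewrite /f -Quotient.idealrBE -opprB rpredN.
rewrite (_ : _ - _ = D *: \row_j divz (x 0 j) D) ?DI//.
apply/rowP => j; rewrite !mxE ffunE inordK.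
  by rewrite gez0_abs ?modz_ge0// {1}(divz_eq (x 0 j) D) addrK mulrC.
by have := modz_ge0 (x 0 j) D0; have := ltz_mod (x 0 j) D0; lia.
Qed.

(** * The lattice spanned by the lifted vertices *)

Lemma LambdaP (d : nat) (v : 'I_d.+1 -> 'rV[int]_d) (x : 'rV[int]_(d + 1)) :
  x \in Lambda v <->
  exists a : 'I_d.+1 -> int, x = \sum_i lifted (v i) *~ a i.
Proof.
split=> [/asboolP[a ->]|[a ->]];
  [exists a | apply/asboolP; exists [ffun i => a i]].
  by apply: eq_bigr => i _; rewrite -tnth_nth tnth_mktuple.
by apply: eq_bigr => i _; rewrite -tnth_nth tnth_mktuple ffunE.
Qed.

Lemma mxMz_entry (m n : nat) (A : 'M[int]_(m, n)) (z : int) i j :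
  (A *~ z) i j = A i j * z.
Proof. by rewrite -scaler_int mxE intz mulrC. Qed.

(** The last coordinate of the lifted relation gives the sum of the coefficients, the others give
    the relation between points. *)
Lemma lifted_Lambda (d : nat) (v : 'I_d.+1 -> 'rV[int]_d) (x : 'rV[int]_d)
    (n : nat) :
  lifted x *+ n \in Lambda v ->
  exists a : 'I_d.+1 -> int, \sum_i a i = n%:Z /\ x *+ n = \sum_i v i *~ a i.
Proof.
case/LambdaP=> a xa; exists a.
have xaj j : lifted x 0 j *+ n = \sum_i lifted (v i) 0 j * a i.
  rewrite -mulmxnE xa summxE; apply: eq_bigr => i _.
  by rewrite mxMz_entry.
split.
  have := xaj (rshift d 0); rewrite row_mxEr mxE natz => ->.
  by apply: eq_bigr => i _; rewrite row_mxEr mxE mul1r.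
apply/rowP => j; have := xaj (lshift 1 j); rewrite mulmxnE summxE row_mxEl => ->.
by apply: eq_bigr => i _; rewrite row_mxEl mxMz_entry.
Qed.

Section Simplex.
Variables (R : realFieldType) (d : nat) (v : 'I_d.+1 -> 'rV[int]_d).

Hypothesis v_indep : forall c : 'I_d.+1 -> R,
  \sum_i c i = 0 -> \sum_i c i *: map_mx intr (v i) = 0 -> forall i, c i = 0.

(** Cramer's rule: [D] is the determinant of the matrix of lifted vertices, and its adjugate
    supplies integer coefficients for [D *: x]. *)
Lemma Lambda_finite_index :
  exists2 D : int, D != 0 & forall x, D *: x \in Lambda v.
Proof.
(* The lifting coordinate comes first because [1 + d], unlike [d + 1], is
   convertible to [d.+1], so that [M] is square. *)
pose M : 'M[int]_(1 + d) := \matrix_(i, j) row_mx (const_mx 1) (v i) 0 j.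
have Ml i (k : 'I_1) : M i (lshift d k) = 1 by rewrite mxE row_mxEl mxE.
have Mr i k : M i (rshift 1 k) = v i 0 k by rewrite mxE row_mxEr.
have D0 : \det M != 0.
  (* If the determinant vanished, a nonzero real row [c] would satisfy [c *m M = 0]: its entries
     would sum to 0 and annihilate the vertices, against [v_indep]. *)
  rewrite -(intr_eq0 R) -det_map_mx; apply/negP => /det0P[c c0 cM].
  have cj j : \sum_i c 0 i * (M i j)%:~R = 0.
    have := congr1 (fun y : 'rV_(1 + d) => y 0 j) cM; rewrite !mxE => cMj.
    by rewrite -[RHS]cMj; apply: eq_bigr => i _; rewrite !mxE.
  case/negP: c0; apply/eqP/rowP => i; rewrite mxE.
  apply: (v_indep (c := c 0)).
    rewrite -[RHS](cj (lshift d 0)); apply: eq_bigr => k _.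
    by rewrite Ml mulr1.
  apply/rowP => j; rewrite summxE mxE -[RHS](cj (rshift 1 j)).
  by apply: eq_bigr => k _; rewrite Mr !mxE.
exists (\det M) => // x; apply/LambdaP.
(* The blocks of [x] are swapped to match the column order of [M]. *)
pose y : 'rV_(1 + d) := row_mx (rsubmx x) (lsubmx x).
exists (fun i => (y *m \adj M) 0 i).
have yM j : \sum_i (y *m \adj M) 0 i * M i j = \det M * y 0 j.
  have := congr1 (fun z : 'rV_(1 + d) => z 0 j)
    (mulmxA y (\adj M) M); rewrite mul_adj_mx mul_mx_scalar !mxE => ->.
  by apply: eq_bigr => i _; rewrite !mxE.
apply/rowP => j; rewrite mxE summxE; case: (split_ordP j) => k ->.
  rewrite -[x in LHS]hsubmxK row_mxEl -(row_mxEr (rsubmx x)) -yM.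
  by apply: eq_bigr => i _; rewrite mxMz_entry row_mxEl Mr mulrC.
rewrite -[x in LHS]hsubmxK row_mxEr -(row_mxEl _ (lsubmx x)) -yM.
apply: eq_bigr => i _.
by rewrite mxMz_entry row_mxEr [const_mx _ _ _]mxE Ml mulr1 mul1r.
Qed.

(** Both [a] and [n * t] express [n x] with total weight [n], so affine independence forces
    [a i = n * t i]. *)
Lemma barycentric_ge0 (x : 'rV[int]_d) (n : nat) (t : 'I_d.+1 -> R)
    (a : 'I_d.+1 -> int) :
  (forall i, 0 <= t i) -> \sum_i t i = 1 ->
  map_mx intr x = \sum_i t i *: map_mx intr (v i) ->
  \sum_i a i = n%:Z -> x *+ n = \sum_i v i *~ a i -> forall i, 0 <= a i.
Proof.
move=> t0 t1 xt an xa i.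
have : (a i)%:~R - n%:R * t i = 0.
  apply: (v_indep (c := fun i => (a i)%:~R - n%:R * t i)).
    rewrite sumrB -mulr_sumr t1 mulr1 -rmorph_sum/= an; apply/subrr.
  under eq_bigr do rewrite scalerBl -scalerA.
  rewrite sumrB -scaler_sumr -xt.
  apply/eqP; rewrite subr_eq0; apply/eqP.
  rewrite scaler_nat -raddfMn xa [RHS]raddf_sum.
  by apply: eq_bigr => k _; rewrite raddfMz scaler_int.
move/eqP; rewrite subr_eq0 -(ler0z R) => /eqP ->.
by rewrite mulr_ge0.
Qed.
End Simplex.

(** * Representations of sumset elements and their reduction *)

(** The multiplicity [c] of the summand 0 is invisible in [x] but needed to keep the number of
    summands equal to [h]. *)
Lemma sumset_representation (V : zmodType) (n : nat) (v : 'I_n -> V) (w : V)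
    (h : nat) (x : V) :
  x \in sumset ([fset v i | i : 'I_n] `|` [fset w; 0])%fset h ->
  exists (a : 'I_n -> nat) (b c : nat),
    (\sum_i a i + b + c)%N = h /\ x = \sum_i v i *+ a i + w *+ b.
Proof.
set A := (_ `|` _)%fset; case/imfsetP=> s _ ->.
suff repr f : (forall i : 'I_h, f i \in A) -> exists (a : 'I_n -> nat) b c,
    (\sum_i a i + b + c)%N = h /\ \sum_i f i = \sum_i v i *+ a i + w *+ b.
  by apply: repr => i; apply: fsvalP.
elim: h {x s} f => [|h IH] f fA.
  exists (fun=> 0%N), 0%N, 0%N; split; first by rewrite big1.
  by rewrite big_ord0 big1 ?addr0 ?mulr0n.
have [a [b [c [abc fE]]]] := IH (fun i => f (lift ord0 i)) (fun i => fA _).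
rewrite big_ord_recl fE; have := fA ord0.
rewrite !inE => /orP[/imfsetP[i _ ->]|/orP[]/eqP->].
- exists (fun j => (j == i) + a j)%N, b, c; split.
    rewrite big_split/= (bigD1 i)//= eqxx (@big1 _ _ addn) -?abc//.
    by move=> j /negbTE ->.
  under [in RHS]eq_bigr do rewrite mulrnDr.
  rewrite big_split/= addrA; congr (_ + _ + _).
  rewrite (bigD1 i)//= eqxx big1 ?addr0// => j /negbTE ->; exact: mulr0n.
- by exists a, b.+1, c; split; [rewrite -abc; lia | rewrite mulrS addrCA].
- by exists a, b, c.+1; split; [rewrite -abc; lia | rewrite add0r].
Qed.

(** Divide [b] by [p] and [c] by [q]: each block of [p] copies of [w] is traded for [al], each block
    of [q] zeros for [be], and the remainders stay. *)
Lemma representation_reduce (V : zmodType) (n : nat) (v : 'I_n -> V) (w : V)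
    (p q : nat) (al be a : 'I_n -> nat) (b c : nat) :
  (0 < p)%N -> (0 < q)%N ->
  (\sum_i al i)%N = p -> w *+ p = \sum_i v i *+ al i ->
  (\sum_i be i)%N = q -> 0 = \sum_i v i *+ be i ->
  exists (a' : 'I_n -> nat) (b' c' : nat),
    [/\ (b' < p)%N, (c' < q)%N,
        (\sum_i a' i + b' + c' = \sum_i a i + b + c)%N &
        \sum_i v i *+ a' i + w *+ b' = \sum_i v i *+ a i + w *+ b].
Proof.
move=> p0 q0 alp wp beq vbe.
exists (fun i => a i + (b %/ p * al i + c %/ q * be i))%N, (b %% p)%N, (c %% q)%N.
split; rewrite ?ltn_mod//.
  rewrite !big_split/= -!big_distrr/= alp beq.
  by rewrite [in RHS](divn_eq b p) [in RHS](divn_eq c q); lia.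
under eq_bigr do
  rewrite !mulrnDr [(b %/ p * _)%N]mulnC [(c %/ q * _)%N]mulnC !mulrnA.
rewrite !big_split/= !sumrMnl -wp -vbe mul0rn addr0 -addrA; congr (_ + _).
by rewrite -mulrnA -mulrnDr mulnC -divn_eq.
Qed.

(** * Counting reduced representations *)

(** Adding [q] to the head injects the compositions of [n - q] into those of [n] with head at least
    [q], which are disjoint from the ones counted. *)
Lemma card_compositions_head_ltn (k n q : nat) : (q <= n)%N ->
  (#|[set t : k.+1.-tuple 'I_n.+1 |
        (\sum_(i <- t) i == n) && (thead t < q)]%N|
     + 'C(k + (n - q), k) <= 'C(k + n, k))%N.
Proof.
move=> qn; rewrite -!card_ord_partitions.
pose f (t : k.+1.-tuple 'I_(n - q).+1) : k.+1.-tuple 'I_n.+1 :=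
  [tuple of inord (q + thead t) ::
     [tuple of map (fun i : 'I_(n - q).+1 => inord i) (behead t)]].
set S := [set t | _ && _]; set T := [set t : k.+1.-tuple 'I_(n - q).+1 | _].
set U := [set t : k.+1.-tuple 'I_n.+1 | _].
have inordE (i : 'I_(n - q).+1) : (inord i : 'I_n.+1) = i :> nat.
  by rewrite inordK//; have := ltn_ord i; lia.
have inord_qE (i : 'I_(n - q).+1) : (inord (q + i) : 'I_n.+1) = (q + i)%N :> nat.
  by rewrite inordK//; have := ltn_ord i; lia.
have f_inj : injective f.
  move=> s t; case/tupleP: s => x s; case/tupleP: t => y t.
  move/(congr1 val)/eqP; rewrite /= eqseq_cons !theadE => /andP[/eqP xy /eqP st].
  apply/val_inj => /=; congr (_ :: _).
    by apply/val_inj/(@addnI q); rewrite -inord_qE xy inord_qE.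
  by apply: inj_map st => a b /(congr1 val)/=; rewrite !inordE => /val_inj.
rewrite -(card_imset _ f_inj) -cardsUI.
have -> : S :&: f @: T = finset.set0.
  apply/setP => u; rewrite !inE; apply/negP => /andP[/andP[_ uq] /imsetP[t _ ut]].
  by move: uq; rewrite ut /f theadE inord_qE; lia.
rewrite cards0 addn0; apply/subset_leq_card/fintype.subsetP => u.
case/finset.setUP=> [|/imsetP[t]]; rewrite !inE; first by case/andP.
case/tupleP: t => x t /eqP; rewrite big_cons => xt ->.
rewrite /f theadE big_cons inord_qE big_map.
rewrite (eq_bigr (fun i : 'I_(n - q).+1 => i : nat)) => [|i _];
  last exact: inordE.
by rewrite -addnA xt subnKC.
Qed.

Lemma leq_cardfs_cover (T : choiceType) (S : {fset T}) (F : nat -> {fset T})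
    (p : nat) :
  (forall x, x \in S -> exists2 m, (m < p)%N & x \in F m) ->
  (#|` S| <= \sum_(0 <= m < p) #|` F m|)%N.
Proof.
elim: p S => [|p IH] S SF.
  rewrite big_geq// leqn0 cardfs_eq0; apply/eqP/fsetP => x.
  by rewrite inE; apply/negP => /SF[].
rewrite big_nat_recr//= -(cardfsID (F p)) addnC leq_add//.
  apply: IH => x; rewrite inE => /andP[xFp /SF[m]]; rewrite ltnS leq_eqVlt.
  by case/predU1P=> [->|mp xFm]; [rewrite (negbTE xFp) | exists m].
by apply/fsubset_leq_card/fsubsetIr.
Qed.

(** For fixed multiplicity [m] of [w], the rest is a composition of [h - m] with head [c < q]. The
    correction for large heads stands on the left because subtraction in [nat] truncates. *)
Lemma card_reduced_representations (V : zmodType) (n : nat) (v : 'I_n -> V)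
    (w : V) (p q h : nat) (S : {fset V}) :
  (forall x, x \in S -> exists (a : 'I_n -> nat) (b c : nat),
    [/\ (b < p)%N, (c < q)%N, (\sum_i a i + b + c)%N = h &
        x = \sum_i v i *+ a i + w *+ b]) ->
  (#|` S| + \sum_(0 <= m < p | m + q <= h) 'C(n + (h - q - m), n)
     <= \sum_(0 <= m < p | m <= h) 'C(n + (h - m), n))%N.
Proof.
move=> repr.
pose T m := [set t : n.+1.-tuple 'I_(h - m).+1 |
  (\sum_(i <- t) i == h - m) && (thead t < q)]%N.
pose point m (t : n.+1.-tuple 'I_(h - m).+1) : V :=
  \sum_i v i *+ tnth t (lift ord0 i) + w *+ m.
(* For [m > h] the truncated [h - m] would wrongly leave one composition of 0, so the family is cut
   off there. *)
pose F m : {fset V} :=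
  if (m <= h)%N then [fset point m t | t in T m]%fset else fset0.
have SF : (#|` S| <= \sum_(0 <= m < p) #|` F m|)%N.
  apply: leq_cardfs_cover => x /repr[a [b [c [bp cq abc xE]]]]; exists b => //.
  have bh : (b <= h)%N by rewrite -abc; lia.
  have ah i : (a i <= h - b)%N by rewrite -abc (bigD1 i)//=; lia.
  have ch : (c <= h - b)%N by rewrite -abc; lia.
  rewrite /F bh; apply/imfsetP.
  exists [tuple of inord c :: [tuple inord (a i) | i < n]].
    rewrite /= inE theadE inordK ?cq ?andbT//.
    rewrite big_cons inordK// big_map big_enum/=.
    rewrite (eq_bigr a) => [|i _]; last by rewrite inordK// ltnS.
    by rewrite -abc addnAC addnK addnC.
  rewrite xE; congr (_ + _); apply: eq_bigr => i _.
  by rewrite tnthS tnth_mktuple inordK ?ltnS.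
have FT m : (m <= h)%N -> (#|` F m| <= #|T m|)%N.
  move=> mh; rewrite /F mh; apply: leq_trans (leq_imfset_card _ _ _) _.
  by rewrite cardE.
apply: (@leq_trans (\sum_(0 <= m < p) #|` F m| +
  \sum_(0 <= m < p | m + q <= h) 'C(n + (h - q - m), n))%N).
  by rewrite leq_add2r SF.
(* The comparison is termwise in [m]; when [m + q > h] there is no correction and the bound on the
   head is simply dropped. *)
rewrite [X in (_ + X)%N]big_mkcond [leqRHS]big_mkcond -big_split/=.
apply: leq_sum => m _; case: (leqP m h) => mh; last first.
  by rewrite /F (leqNgt m) mh /= ifN//; lia.
case: ifPn => mq.
  rewrite subnAC.
  apply: leq_trans _ (@card_compositions_head_ltn n (h - m) q _); last lia.
  by rewrite leq_add2r FT.
rewrite addn0; apply: leq_trans (FT m mh) _; rewrite -card_ord_partitions.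
by apply/subset_leq_card/fintype.subsetP => t; rewrite !inE => /andP[].
Qed.

(** * Rewriting the sums, and the four ranges of [h] *)

Lemma big_nat_sub_rev (h p : nat) (f : nat -> nat) : (h < p)%N ->
  (\sum_(0 <= m < p | m <= h) f (h - m) = \sum_(0 <= m < h.+1) f m)%N.
Proof.
move=> hp; rewrite [RHS]big_nat_rev [RHS](big_nat_widen _ _ _ _ _ hp)/=.
by apply: eq_bigr => m _; rewrite add0n subSS.
Qed.

Lemma bin_addl_sub (d h m : nat) : (m <= h)%N ->
  'C(h + d + 1 - m, h - m) = 'C(d.+1 + (h - m), d.+1).
Proof.
by move=> mh; rewrite -bin_sub; [congr ('C(_, _)); lia | lia].
Qed.

Unset Implicit Arguments.

Theorem mainTheorem2 (R : realType) (d : nat) (v : 'I_d.+1 -> 'rV[int]_d)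
    (w : 'rV[int]_d) (A : {fset 'rV[int]_d}) :
  (1 <= d)%N ->
  A = ([fset v i | i : 'I_d.+1] `|` [fset w; 0])%fset ->
  #|` A|%fset = (d + 3)%N ->
  generates (diffset A) ->
  simplex_with_vertices (conv_hull (real_points R A))
    (fun i => map_mx intr (v i)) ->
  let N := N_Lambda v in
  let o := o_ v w in
  forall h : nat,
  [/\ (h <= o - 1)%N ->
        #|` sumset A h|%fset%:Z <= \sum_(0 <= m < h.+1) 'C(m + d + 1, m)%:Z,
      (o <= h <= N - 1)%N ->
        #|` sumset A h|%fset%:Z
          <= \sum_(0 <= m < o) 'C(h + d + 1 - m, h - m)%:Z,
      (N <= h <= N + o - 1)%N ->
        #|` sumset A h|%fset%:Z
          <= \sum_(0 <= m < o) 'C(h + d + 1 - m, h - m)%:Z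
             - \sum_(0 <= m < (h - N).+1) 'C(m + d + 1, m)%:Z
    & (N + o <= h)%N ->
        #|` sumset A h|%fset%:Z
          <= \sum_(0 <= m < o) 'C(h + d + 1 - m, h - m)%:Z
             - \sum_(0 <= m < o) 'C(h - N + d + 1 - m, h - N - m)%:Z].
Proof.
move=> _ AE _ _ [v_free v_conv] N o h.
have v_indep c :=
  @free_affine_independent R _ _ (fun i => map_mx intr (v i)) c v_free.
(* Finite index makes [N] the true order of the quotient, not the default 0. *)
have [D D0 DL] := Lambda_finite_index v_indep.
have N0 : (0 < N)%N by exact/group_order_gt0/(finite_quotient D0).
pose Q := Quotient.quot (Lambda v).
have killed (x : Q) : x *+ N = 0 by exact: mulrn_group_order.
have [o0 wo] : (0 < o)%N /\ \pi_Q%qT (lifted w) *+ o = 0.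
  exact: mulrn_order_of N0 (killed _).
have piMn x n : \pi_Q%qT x *+ n = 0 -> x *+ n \in Lambda v.
  move=> xn; rewrite -[_ *+ _]subr0 Quotient.idealrBE; apply/eqP.
  by rewrite raddfMn raddf0.
(* Points of [A] lie in the simplex, so the integer coefficients are nonnegative and count summands;
   this serves for [w] and for 0. *)
have relation x n : x \in A -> lifted x *+ n \in Lambda v ->
    exists a : 'I_d.+1 -> nat, (\sum_i a i)%N = n /\ x *+ n = \sum_i v i *+ a i.
  move=> xA /lifted_Lambda[a [an xa]].
  have : conv_hull (real_points R A) (map_mx intr x).
    by apply: sub_gen_smallest; exists x.
  rewrite v_conv => /conv_hull_range[t [t0 t1 xt]].
  have a0 := barycentric_ge0 v_indep t0 t1 xt an xa.
  exists (fun i => `|a i|%N); split.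
    apply/eqP; rewrite -eqz_nat -an (big_morph Posz PoszD (erefl 0%:Z)).
    by apply/eqP/eq_bigr => i _; rewrite gez0_abs.
  by rewrite xa; apply: eq_bigr => i _; rewrite -{1}[a i]gez0_abs.
have [al [alo wal]] : exists a : 'I_d.+1 -> nat,
    (\sum_i a i)%N = o /\ w *+ o = \sum_i v i *+ a i.
  by apply: relation; [rewrite AE !inE eqxx orbT | exact: piMn].
have [be [beN zbe]] : exists a : 'I_d.+1 -> nat,
    (\sum_i a i)%N = N /\ 0 *+ N = \sum_i v i *+ a i.
  by apply: relation; [rewrite AE !inE eqxx !orbT | exact/piMn/killed].
rewrite mul0rn in zbe.
have := @card_reduced_representations _ _ v w o N h (sumset A h).
have reduced x : x \in sumset A h -> exists (a : 'I_d.+1 -> nat) (b c : nat),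
    [/\ (b < o)%N, (c < N)%N, (\sum_i a i + b + c)%N = h &
        x = \sum_i v i *+ a i + w *+ b].
  rewrite AE => /sumset_representation[a [b [c [<- ->]]]].
  have [a' [b' [c' [b'o c'N <- <-]]]] :=
    representation_reduce a b c o0 N0 alo wal beN zbe.
  by exists a', b', c'.
move/(_ reduced).
set G := (\sum_(0 <= m < o | _) _)%N; set F := (\sum_(0 <= m < o | _) _)%N => GF.
have binE m : 'C(m + d + 1, m) = 'C(d.+1 + m, d.+1).
  by have := bin_addl_sub d (leq0n m); rewrite !subn0.
(* Only an inequality: for [m > h] the right-hand binomial is 1 by truncation, while [F] has no such
   term. *)
have F_le : (F <= \sum_(0 <= m < o) 'C(h + d + 1 - m, h - m))%N.
  rewrite /F big_mkcond; apply: leq_sum => m _.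
  by case: (leqP m h) => // mh; rewrite bin_addl_sub.
split=> hb; rewrite -!(big_morph Posz PoszD (erefl 0%:Z)).
- rewrite lez_nat (leq_trans (leq_addr G _))// (leq_trans GF)//.
  (* Since [o > 0], here [h < o], so the sum stops at [m = h] and can be reversed. *)
  rewrite /F (@big_nat_sub_rev _ _ (fun m => 'C(d.+1 + m, d.+1))); last lia.
  by under [leqRHS]eq_bigr do rewrite binE.
- by rewrite lez_nat (leq_trans (leq_addr G _))// (leq_trans GF).
- rewrite lerBrDr -PoszD lez_nat (leq_trans _ (leq_trans GF F_le))//.
  rewrite leq_add2l /G.
  (* As [N <= h], the condition reads [m <= h - N], and [h - N < o] permits the same reversal. *)
  have -> : (\sum_(0 <= m < o | m + N <= h) 'C(d.+1 + (h - N - m), d.+1) =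
      \sum_(0 <= m < o | m <= h - N) 'C(d.+1 + (h - N - m), d.+1))%N.
    by apply: eq_bigl => m; lia.
  rewrite (@big_nat_sub_rev _ _ (fun m => 'C(d.+1 + m, d.+1))); last lia.
  by under eq_bigr do rewrite binE.
- rewrite lerBrDr -PoszD lez_nat (leq_trans _ (leq_trans GF F_le))//.
  (* Here every [m < o] satisfies [m + N <= h], so the correction is the full sum. *)
  rewrite leq_add2l /G [leqRHS]big_mkcond big_nat [leqRHS]big_nat.
  by apply: leq_sum => m /andP[_ mo]; rewrite bin_addl_sub ?ifT//; lia.
Qed.
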